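(* For $t>0$ small enough and a singular point $(f(z_0,t_0),t_0)$ of the equation $$\frac{df(z,t)}{dt}=\frac{2}{f(z,t)-\sqrt[3]{t}},\qquad f(z,0)=z,\qquad \operatorname{Im} z\ge 0,$$ with $0<t_0<t$, the following inequalities hold: $$f_2(0,t)<f_2(z_0,t)<\sqrt[3]{t}<f_1(z_0,t)<f_1(0,t).$$ Here ''$t>0$ small enough'' means that there is $T'>0$, independent of $t_0$ and $z_0$, such that the inequalities hold whenever $0<t_0<t<T'$.
   Context: A point $(f(z_0,t_0),t_0)$ with $t_0>0$ is a singular point of the equation if $f(z_0,t_0)=\sqrt[3]{t_0}$. The functions $f_1(0,t)$ and $f_2(0,t)$ are the two real singular solutions of $\frac{dy}{dt}=\frac{2}{y-\sqrt[3]{t}}$, $t>0$, with $f_1(0,0)=f_2(0,0)=0$; they satisfy, as $t\to+0$, $$f_1(0,t)=\sqrt[3]{t}+6\sqrt[3]{t^2}-72t+o(t),\qquad f_2(0,t)=-3\sqrt[3]{t^2}+o(\sqrt[3]{t^2}).$$ For a singular point with $t_0>0$, the functions $f_1(z_0,t)$ and $f_2(z_0,t)$, $t\ge t_0$, are the two real branches of the solution through $(\sqrt[3]{t_0},t_0)$, which expand near $t_0$ in powers of $(t-t_0)^{1/2}$: they are continuous on $t\ge t_0$, satisfy $\frac{dy}{dt}=\frac{2}{y-\sqrt[3]{t}}$ for $t>t_0$ and $y(t_0)=\sqrt[3]{t_0}$, and as $t\to t_0+0$, $$f_1(z_0,t)=\sqrt[3]{t_0}+2\sqrt{t-t_0}+o(\sqrt{t-t_0}),\qquad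 f_2(z_0,t)=\sqrt[3]{t_0}-2\sqrt{t-t_0}+o(\sqrt{t-t_0}).$$ *)

(* Defs.v *)
From Stdlib Require Import Reals.
From Coquelicot Require Import Coquelicot.
Open Scope R_scope.

(* [Rpower 0 _] is 1, hence the case distinction; the value at negative
   arguments is irrelevant, since only times [t >= 0] occur. *)
Definition cbrt (t : R) : R :=
  if Rlt_dec 0 t then Rpower t (1 / 3) else 0.

(* The equation is imposed only on (0, t0): at [t = 0] it is covered by
   continuity when [z <> 0] and has no meaning when [z = 0].  Division being
   total, the non-vanishing of the denominator must be required. *)
Definition loewner_solution (f : R -> C) (z : C) (t0 : R) : Prop :=
  f 0 = z /\
  continuous_on (U := C_UniformSpace) (fun t => 0 <= t <= t0) f /\
  forall t, 0 < t < t0 ->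
    f t <> RtoC (cbrt t) /\
    is_derive (K := R_AbsRing) (V := C_R_NormedModule) f t
      (2 / (f t - cbrt t))%C.

Definition singular_point (f : R -> C) (z0 : C) (t0 : R) : Prop :=
  0 < t0 /\ 0 <= Im z0 /\ loewner_solution f z0 t0 /\ f t0 = RtoC (cbrt t0).

(* Real branch issuing from the singular point (cbrt t0, t0). *)
Definition real_singular_solution (t0 : R) (y : R -> R) : Prop :=
  y t0 = cbrt t0 /\
  continuous_on (fun t => t0 <= t) y /\
  forall t, t0 < t ->
    y t <> cbrt t /\ is_derive y t (2 / (y t - cbrt t)).

(* [little_o t0 g h] means h(t) = o(g(t)) as t -> t0 + 0. *)
Definition little_o (t0 : R) (g h : R -> R) : Prop :=
  is_domin (at_right t0) g h.

(* f_1(0, .) and f_2(0, .); the [_branch] versions further below are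
   f_1(z0, .) and f_2(z0, .), which depend on [z0] through [t0] only and are
   identified by their leading behaviour at [t0]. *)
Definition is_f1_0 (y : R -> R) : Prop :=
  real_singular_solution 0 y /\
  little_o 0 (fun t => t)
    (fun t => y t - (cbrt t + 6 * cbrt (t ^ 2) - 72 * t)).

Definition is_f2_0 (y : R -> R) : Prop :=
  real_singular_solution 0 y /\
  little_o 0 (fun t => cbrt (t ^ 2))
    (fun t => y t - (- 3 * cbrt (t ^ 2))).

Definition is_f1_branch (t0 : R) (y : R -> R) : Prop :=
  real_singular_solution t0 y /\
  little_o t0 (fun t => sqrt (t - t0))
    (fun t => y t - (cbrt t0 + 2 * sqrt (t - t0))).

Definition is_f2_branch (t0 : R) (y : R -> R) : Prop :=
  real_singular_solution t0 y /\
  little_o t0 (fun t => sqrt (t - t0))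
    (fun t => y t - (cbrt t0 - 2 * sqrt (t - t0))).

(* Main.v *)
(** Every real solution [y] of the equation keeps the sign of [y - cbrt t],
    because it never meets the curve of singular points.  The expansions
    determine this sign near the starting time, which gives the two middle
    inequalities.  The difference [D] of two solutions [y1], [y2] satisfies the
    linear equation [D' = - 2 D / ((y1 - cbrt t) (y2 - cbrt t))], so it keeps its
    sign on any interval where neither is singular; at [t0] the branch sits on
    the singular curve, while the solution issuing from 0 is off it. *)
Require Import Defs.
From Stdlib Require Import Reals Lra Ranalysis5.
From Coquelicot Require Import Coquelicot.
Open Scope R_scope.

(** * The cube root on the positive half-line *)

Lemma Rpower_third_pow3 (t : R) : 0 < t -> Rpower t (1 / 3) ^ 3 = t.
Proof.
intros Ht.
rewrite <- Rpower_pow by (unfold Rpower; apply exp_pos).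
rewrite Rpower_mult.
replace (1 / 3 * INR 3) with 1 by (simpl; field).
now apply Rpower_1.
Qed.

Lemma cbrt_pos (t : R) : 0 < t -> 0 < cbrt t.
Proof.
intros Ht; unfold cbrt; destruct (Rlt_dec 0 t); [|lra].
unfold Rpower; apply exp_pos.
Qed.

Lemma cbrt_pow3 (t : R) : 0 < t -> cbrt t ^ 3 = t.
Proof.
intros Ht; unfold cbrt; destruct (Rlt_dec 0 t); [|lra].
now apply Rpower_third_pow3.
Qed.

Lemma cbrt_cube (x : R) : 0 < x -> cbrt (x ^ 3) = x.
Proof.
intros Hx.
assert (H3 : 0 < x ^ 3) by (apply pow_lt; lra).
assert (Hp := cbrt_pos _ H3); assert (He := cbrt_pow3 _ H3).
set (y := cbrt (x ^ 3)) in *.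
assert (H : (y - x) * (y * y + y * x + x * x) = 0) by
  (transitivity (y ^ 3 - x ^ 3); [ring|lra]).
apply Rmult_integral in H; destruct H as [H|H]; nra.
Qed.

Lemma continuous_cbrt (t : R) : 0 < t -> continuous cbrt t.
Proof.
intros Ht.
apply (continuous_ext_loc _ (fun x => exp (1 / 3 * ln x))).
- exists (mkposreal t Ht); intros x Hx.
  apply Rabs_lt_between' in Hx; simpl in Hx.
  unfold cbrt; destruct (Rlt_dec 0 x); [reflexivity|lra].
- apply (ex_derive_continuous (V := R_NormedModule)).
  auto_derive; lra.
Qed.

(** * Persistence of sign, for nonvanishing functions and for linear equations *)

Lemma same_sign_of_nonzero (g : R -> R) (a s t : R) :
  (forall x, a < x -> continuous g x) -> (forall x, a < x -> g x <> 0) ->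
  a < s -> a < t -> 0 < g s -> 0 < g t.
Proof.
intros Hc Hn Hs Ht Hgs.
destruct (Rlt_or_le 0 (g t)) as [H|H]; [exact H|exfalso].
assert (Hgt : g t < 0) by (specialize (Hn t Ht); lra).
(* In either order of [s] and [t], the intermediate value theorem yields a forbidden zero. *)
destruct (Rtotal_order s t) as [L|[L|L]].
- destruct (IVT_interv (fun x => - g x) s t) as [z [Hz Hgz]]; try lra.
  + intros x Hx; apply continuity_pt_filterlim.
    apply (continuous_opp (V := R_NormedModule)), Hc; lra.
  + apply (Hn z); lra.
- subst; lra.
- destruct (IVT_interv g t s) as [z [Hz Hgz]]; try lra.
  + intros x Hx; apply continuity_pt_filterlim, Hc; lra.
  + apply (Hn z); lra.
Qed.

(** Integrating factor: if [K] is a primitive of [k], then [D * exp (- K)] has zero derivative, and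
    the exponential is positive. *)
Lemma linear_ode_pos (D k : R -> R) (a s t : R) :
  (forall x, a < x -> continuous k x) ->
  (forall x, a < x -> is_derive D x (k x * D x)) ->
  a < s -> s < t -> 0 < D s -> 0 < D t.
Proof.
intros Hk HD Hs Hst HDs.
set (K := fun x => RInt k s x).
assert (HK : forall x, s <= x -> is_derive K x (k x)).
(* The derivative is two-sided, so at [x = s] points below [s] occur too; the radius [x - a] keeps
   them to the right of [a], where [k] is continuous. *)
{ intros x Hx; apply (is_derive_RInt k K s x); [|apply Hk; lra].
  assert (Hxa : 0 < x - a) by lra.
  exists (mkposreal _ Hxa); intros y Hy.
  apply Rabs_lt_between' in Hy; simpl in Hy.
  apply (RInt_correct (V := R_CompleteNormedModule)), ex_RInt_continuous.
  intros z [Hz _]; apply Hk.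
  assert (a < Rmin s y) by (apply Rmin_glb_lt; lra); lra. }
assert (Hconst : D s * exp (- K s) = D t * exp (- K t)).
{ apply (eq_is_derive (V := R_NormedModule)
    (fun x => D x * exp (- K x)) s t); [|lra].
  intros x Hx.
  assert (Hdx := HD x ltac:(lra)); assert (Hkx := HK x ltac:(lra)).
  auto_derive.
  - split; [now exists (k x * D x)|split; [now exists (k x)|exact I]].
  - replace (Derive (fun x0 => D x0) x) with (k x * D x)
      by (symmetry; now apply is_derive_unique).
    replace (Derive (fun x0 => K x0) x) with (k x)
      by (symmetry; now apply is_derive_unique).
    transitivity 0; [ring|reflexivity]. }
assert (He := exp_pos (- K s)); assert (He' := exp_pos (- K t)).
assert (0 < D s * exp (- K s)) by now apply Rmult_lt_0_compat.
nra.
Qed.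

(** * Solutions off the singular curve and their comparison *)

(** Nothing is asked at [t0] itself, so the property passes to later starting times; a solution
    issuing from 0 can thus be compared with a branch issuing from [t0]. *)
Definition regular_solution (t0 : R) (y : R -> R) : Prop :=
  forall t, t0 < t ->
    y t <> cbrt t /\ is_derive y t (2 / (y t - cbrt t)).

Lemma regular_solution_continuous (t0 t : R) (y : R -> R) :
  regular_solution t0 y -> t0 < t -> continuous y t.
Proof.
intros Hy Ht; destruct (Hy t Ht) as [_ Hd].
apply (ex_derive_continuous (V := R_NormedModule)); eexists; exact Hd.
Qed.

Lemma regular_solution_above (t0 s t : R) (y : R -> R) :
  0 <= t0 -> regular_solution t0 y -> t0 < s -> t0 < t ->
  cbrt s < y s -> cbrt t < y t.
Proof.
intros H0 Hy Hs Ht Hys.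
enough (0 < y t - cbrt t) by lra.
apply (same_sign_of_nonzero (fun x => y x - cbrt x) t0 s t); try lra.
- intros x Hx; apply (continuous_minus (V := R_NormedModule)).
  + now apply regular_solution_continuous with t0.
  + apply continuous_cbrt; lra.
- intros x Hx; destruct (Hy x Hx); lra.
Qed.

Lemma regular_solution_below (t0 s t : R) (y : R -> R) :
  0 <= t0 -> regular_solution t0 y -> t0 < s -> t0 < t ->
  y s < cbrt s -> y t < cbrt t.
Proof.
intros H0 Hy Hs Ht Hys.
enough (0 < cbrt t - y t) by lra.
apply (same_sign_of_nonzero (fun x => cbrt x - y x) t0 s t); try lra.
- intros x Hx; apply (continuous_minus (V := R_NormedModule)).
  + apply continuous_cbrt; lra.
  + now apply regular_solution_continuous with t0.
- intros x Hx; destruct (Hy x Hx); lra.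
Qed.

(** The coefficient of the linear equation may blow up at [t0], so continuity first carries the
    strict inequality to a slightly later time [s], and [linear_ode_pos] takes over from there. *)
Lemma regular_solution_lt (t0 t : R) (y1 y2 : R -> R) :
  0 <= t0 ->
  continuous_on (fun x => t0 <= x) y1 -> continuous_on (fun x => t0 <= x) y2 ->
  regular_solution t0 y1 -> regular_solution t0 y2 ->
  y1 t0 < y2 t0 -> t0 < t -> y1 t < y2 t.
Proof.
intros H0 Hc1 Hc2 Hy1 Hy2 Hlt Ht.
(* If each function moves by less than half the initial gap, their order is preserved. *)
assert (He : 0 < (y2 t0 - y1 t0) / 2) by lra.
destruct (Hc1 t0 (Rle_refl t0) _ (locally_ball _ (mkposreal _ He)))
  as [d1 Hd1].
destruct (Hc2 t0 (Rle_refl t0) _ (locally_ball _ (mkposreal _ He)))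
  as [d2 Hd2].
set (m := Rmin (t - t0) (Rmin d1 d2)).
assert (Hm : 0 < m).
{ unfold m; repeat apply Rmin_glb_lt; try apply cond_pos; lra. }
assert (Hm0 : m <= t - t0) by apply Rmin_l.
assert (Hm12 : m <= Rmin d1 d2) by apply Rmin_r.
assert (Hm1 := Rmin_l d1 d2); assert (Hm2 := Rmin_r d1 d2).
set (s := t0 + m / 2).
assert (Hs : t0 < s < t) by (unfold s; lra).
assert (B1 : ball t0 d1 s).
{ apply Rabs_lt_between'; unfold s; lra. }
assert (B2 : ball t0 d2 s).
{ apply Rabs_lt_between'; unfold s; lra. }
specialize (Hd1 s B1 ltac:(lra)); specialize (Hd2 s B2 ltac:(lra)).
apply Rabs_lt_between' in Hd1; apply Rabs_lt_between' in Hd2; simpl in Hd1, Hd2.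
enough (0 < y2 t - y1 t) by lra.
apply (linear_ode_pos (fun x => y2 x - y1 x)
  (fun x => - 2 / ((y1 x - cbrt x) * (y2 x - cbrt x))) t0 s t); try lra.
- intros x Hx.
  destruct (Hy1 x Hx) as [N1 _]; destruct (Hy2 x Hx) as [N2 _].
  assert (C1 := regular_solution_continuous _ _ _ Hy1 Hx).
  assert (C2 := regular_solution_continuous _ _ _ Hy2 Hx).
  assert (Cc := continuous_cbrt x ltac:(lra)).
  apply (continuous_mult (K := R_AbsRing)); [apply continuous_const|].
  apply continuous_Rinv_comp.
  + apply (continuous_mult (K := R_AbsRing));
      now apply (continuous_minus (V := R_NormedModule)).
  + apply Rmult_integral_contrapositive; split; lra.
- intros x Hx.
  destruct (Hy1 x Hx) as [N1 D1]; destruct (Hy2 x Hx) as [N2 D2].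
  assert (D := is_derive_minus (V := R_NormedModule) _ _ _ _ _ D2 D1).
  eapply (eq_ind _ (is_derive _ x) D).
  unfold minus, plus, opp; simpl; field; split; lra.
Qed.

(** * Position relative to the singular curve, read off the expansions *)

Lemma at_right_point (t0 : R) (P : R -> Prop) :
  at_right t0 P -> exists d, 0 < d /\ forall t, t0 < t < t0 + d -> P t.
Proof.
intros [d Hd]; exists d; split; [apply cond_pos|].
intros t Ht; apply Hd; [|lra].
apply Rabs_lt_between'; lra.
Qed.

Lemma is_f1_0_above (y : R -> R) (t : R) : is_f1_0 y -> 0 < t -> cbrt t < y t.
Proof.
intros [[_ [_ Hy]] Ho] Ht.
destruct (at_right_point _ _ (Ho (mkposreal 1 Rlt_0_1))) as [d [Hd HP]].
(* At time [e ^ 3] the expansion is polynomial in [e]. With error at most [e ^ 3], [y - cbrt] is at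
   least [e ^ 2 * (6 - 73 * e)], positive since [1 / 13 < 6 / 73]. *)
set (m := Rmin (1 / 13) d).
assert (Hm : 0 < m) by (apply Rmin_glb_lt; lra).
assert (Hm1 := Rmin_l (1 / 13) d); assert (Hm2 := Rmin_r (1 / 13) d).
fold m in Hm1, Hm2.
set (e := m / 2).
assert (He : 0 < e < d /\ e < 1 / 13) by (unfold e; lra).
assert (He3 : 0 < e ^ 3) by (apply pow_lt; lra).
assert (He3d : e ^ 3 < d) by nra.
apply (regular_solution_above 0 (e ^ 3) t y); try lra; [exact Hy|].
specialize (HP (e ^ 3) ltac:(lra)).
change (Rabs (y (e ^ 3) -
    (cbrt (e ^ 3) + 6 * cbrt ((e ^ 3) ^ 2) - 72 * e ^ 3))
  <= 1 * Rabs (e ^ 3)) in HP.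
replace ((e ^ 3) ^ 2) with ((e ^ 2) ^ 3) in HP by ring.
rewrite !cbrt_cube in HP by nra.
rewrite (Rabs_pos_eq (e ^ 3)) in HP by lra.
apply Rabs_le_between in HP.
rewrite cbrt_cube by lra.
nra.
Qed.

Lemma is_f2_0_below (y : R -> R) (t : R) : is_f2_0 y -> 0 < t -> y t < cbrt t.
Proof.
intros [[_ [_ Hy]] Ho] Ht.
destruct (at_right_point _ _ (Ho (mkposreal 1 Rlt_0_1))) as [d [Hd HP]].
(* At time [e ^ 3] the solution is at most [- 3 * e ^ 2 + e ^ 2], hence negative, while the cube
   root is [e]. The bound 1 ensures [e ^ 3 < d]. *)
set (m := Rmin 1 d).
assert (Hm : 0 < m) by (apply Rmin_glb_lt; lra).
assert (Hm1 := Rmin_l 1 d); assert (Hm2 := Rmin_r 1 d).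
fold m in Hm1, Hm2.
set (e := m / 2).
assert (He : 0 < e < d /\ e < 1) by (unfold e; lra).
assert (He3 : 0 < e ^ 3) by (apply pow_lt; lra).
assert (He3d : e ^ 3 < d) by nra.
apply (regular_solution_below 0 (e ^ 3) t y); try lra; [exact Hy|].
specialize (HP (e ^ 3) ltac:(lra)).
change (Rabs (y (e ^ 3) - (- 3 * cbrt ((e ^ 3) ^ 2)))
  <= 1 * Rabs (cbrt ((e ^ 3) ^ 2))) in HP.
replace ((e ^ 3) ^ 2) with ((e ^ 2) ^ 3) in HP by ring.
rewrite !cbrt_cube in HP by nra.
rewrite (Rabs_pos_eq (e ^ 2)) in HP by nra.
apply Rabs_le_between in HP.
rewrite cbrt_cube by lra.
nra.
Qed.

(** Factor [r ^ 3 - r0 ^ 3 = h]; the quadratic factor is at least [3 * r0 ^ 2]. This linear growth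
    is what the square root term of a branch dominates. *)
Lemma cbrt_increment (t0 h : R) :
  0 < t0 -> 0 < h -> 0 < cbrt (t0 + h) - cbrt t0 <= h / (3 * cbrt t0 ^ 2).
Proof.
intros H0 Hh.
assert (P0 := cbrt_pos t0 H0); assert (P1 := cbrt_pos (t0 + h) ltac:(lra)).
assert (E0 := cbrt_pow3 t0 H0); assert (E1 := cbrt_pow3 (t0 + h) ltac:(lra)).
set (r0 := cbrt t0) in *; set (r := cbrt (t0 + h)) in *.
assert (H : (r - r0) * (r * r + r * r0 + r0 * r0) = h) by
  (transitivity (r ^ 3 - r0 ^ 3); [ring|lra]).
assert (Hr : 0 < r - r0).
{ apply (Rmult_lt_reg_r (r * r + r * r0 + r0 * r0)); [nra|lra]. }
split; [exact Hr|].
apply Rle_div_r; [nra|].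
rewrite <- H; apply Rmult_le_compat_l; nra.
Qed.

Lemma is_f1_branch_above (t0 : R) (y : R -> R) (t : R) :
  0 < t0 -> is_f1_branch t0 y -> t0 < t -> cbrt t < y t.
Proof.
intros H0 [[_ [_ Hy]] Ho] Ht.
destruct (at_right_point _ _ (Ho (mkposreal 1 Rlt_0_1))) as [d [Hd HP]].
assert (P0 := cbrt_pos t0 H0).
assert (P2 : 0 < cbrt t0 ^ 2) by (apply pow_lt; lra).
(* At time [t0 + s ^ 2] the branch has risen by at least [2 * s - s], the cube root by at most
   [s ^ 2 / (3 * cbrt t0 ^ 2)], which is below [s] once [s < cbrt t0 ^ 2]. *)
set (m := Rmin (Rmin 1 d) (cbrt t0 ^ 2)).
assert (Hm : 0 < m) by (repeat apply Rmin_glb_lt; lra).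
assert (Hm1 := Rmin_l 1 d); assert (Hm2 := Rmin_r 1 d).
assert (Hm3 : m <= Rmin 1 d) by apply Rmin_l.
assert (Hm4 : m <= cbrt t0 ^ 2) by apply Rmin_r.
set (s := m / 2).
assert (Hs : 0 < s < 1 /\ s < d /\ s < cbrt t0 ^ 2) by (unfold s; lra).
assert (Hs2 : 0 < s ^ 2 < d) by nra.
apply (regular_solution_above t0 (t0 + s ^ 2) t y); try lra; [exact Hy|].
specialize (HP (t0 + s ^ 2) ltac:(lra)).
replace (t0 + s ^ 2 - t0) with (s ^ 2) in HP by ring.
rewrite sqrt_pow2 in HP by lra.
change (Rabs (y (t0 + s ^ 2) - (cbrt t0 + 2 * s)) <= 1 * Rabs s) in HP.
rewrite (Rabs_pos_eq s) in HP by lra.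
apply Rabs_le_between in HP.
destruct (cbrt_increment t0 (s ^ 2) H0 ltac:(lra)) as [_ Hi].
assert (s ^ 2 / (3 * cbrt t0 ^ 2) < s) by (apply Rlt_div_l; nra).
lra.
Qed.

Lemma is_f2_branch_below (t0 : R) (y : R -> R) (t : R) :
  0 < t0 -> is_f2_branch t0 y -> t0 < t -> y t < cbrt t.
Proof.
intros H0 [[_ [_ Hy]] Ho] Ht.
destruct (at_right_point _ _ (Ho (mkposreal 1 Rlt_0_1))) as [d [Hd HP]].
(* Any time in the range of the estimate serves: the branch has dropped below [cbrt t0] while the
   cube root has increased. *)
specialize (HP (t0 + d / 2) ltac:(lra)).
apply (regular_solution_below t0 (t0 + d / 2) t y); try lra; [exact Hy|].
destruct (cbrt_increment t0 (d / 2) H0 ltac:(lra)) as [Hi _].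
replace (t0 + d / 2 - t0) with (d / 2) in HP by ring.
set (s := sqrt (d / 2)) in *.
assert (Hs : 0 < s) by (apply sqrt_lt_R0; lra).
change (Rabs (y (t0 + d / 2) - (cbrt t0 - 2 * s)) <= 1 * Rabs s) in HP.
rewrite (Rabs_pos_eq s) in HP by lra.
apply Rabs_le_between in HP.
lra.
Qed.

Theorem lemma2 :
  forall f1_0 f2_0 : R -> R,
    is_f1_0 f1_0 -> is_f2_0 f2_0 ->
    exists T' : R, 0 < T' /\
      forall (f : R -> C) (z0 : C) (t0 t : R) (f1 f2 : R -> R),
        singular_point f z0 t0 ->
        is_f1_branch t0 f1 -> is_f2_branch t0 f2 ->
        t0 < t -> t < T' ->
        f2_0 t < f2 t /\ f2 t < cbrt t /\ cbrt t < f1 t /\ f1 t < f1_0 t.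
Proof.
intros g1 g2 Hg1 Hg2.
(* The value 1 is an arbitrary positive choice. *)
exists 1; split; [lra|].
intros f z0 t0 t f1 f2 [H0 _] Hf1 Hf2 Ht _.
(* Both branches equal [cbrt t0] at [t0], so these are the strict initial inequalities for the two
   comparisons. *)
assert (A1 := is_f1_0_above g1 t0 Hg1 H0).
assert (A2 := is_f2_0_below g2 t0 Hg2 H0).
repeat split.
- destruct Hg2 as [[_ [Cg Rg]] _]; destruct Hf2 as [[E [Cf Rf]] _].
  apply (regular_solution_lt t0 t); try lra; try assumption.
  + apply (continuous_on_subset (fun x => 0 <= x)); [intros; lra|exact Cg].
  + intros x Hx; apply Rg; lra.
- now apply (is_f2_branch_below t0).
- now apply (is_f1_branch_above t0).
- destruct Hg1 as [[_ [Cg Rg]] _]; destruct Hf1 as [[E [Cf Rf]] _].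
  apply (regular_solution_lt t0 t); try lra; try assumption.
  + apply (continuous_on_subset (fun x => 0 <= x)); [intros; lra|exact Cg].
  + intros x Hx; apply Rg; lra.
Qed.
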